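(* Let $(X,d,\mu)$ be a $D$-doubling metric measure space with $D\ge 2$, let $\tau\in(0,\frac{1}{D^3}]$, $C>0$ and $\Lambda\ge 1$. If $X$ satisfies a $(\tau,C)$-isoperimetric inequality with inflation factor $\Lambda$, then $X$ satisfies the relative isoperimetric inequality with constants $C_S=D^{7+\log_2(\Lambda)}\,C$ and $\Lambda_S=2\Lambda$; that is, for every ball $B=B(x,r)$ in $X$ and every Borel set $E\subset X$, $$\Theta_\mu(E,B)\le C_S\, r\,\frac{\mathcal{H}_h(\partial E\cap \Lambda_S B)}{\mu(\Lambda_S B)}.$$
   Context: $B(x,r)$ is the open ball with center $x$ and radius $r$, and for $c>0$, $cB=B(x,cr)$. Measures are Radon with $\operatorname{supp}(\mu)=X$ and $\mu(B(x,r))\in(0,\infty)$ for all balls. $(X,d,\mu)$ is $D$-doubling if $0<\mu(B(x,2r))\le D\,\mu(B(x,r))$ for all $x\in X$ and $r\in(0,\operatorname{diam}(X))$. For measurable $E,F\subset X$ with $\mu(F)>0$, $\Theta_\mu(E,F):=\dfrac{\min\{\mu(E\cap F),\mu(F\setminus E)\}}{\mu(F)}$. Codimension-one Hausdorff measure: put $h(B(x,r))=\frac1r\mu(B(x,r))$. For $E\subset X$ and $\delta>0$, $\mathcal{H}_{h,\delta}(E)=\inf\{\sum_{i=1}^\infty h(B(x_i,r_i)) : r_i\le\delta,\ E\subset\bigcup_{i=1}^\infty B(x_i,r_i)\}$ (countable covers by balls), and $\mathcal{H}_h(E)=\lim_{\delta\to0}\mathcal{H}_{h,\delta}(E)$.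 $\partial E$ is the topological boundary of $E$ in $X$. For $\tau,C>0$ and $\Lambda\ge1$, $X$ satisfies a $(\tau,C)$-isoperimetric inequality with inflation factor $\Lambda$ if for every Borel set $E\subset X$ and every ball $B=B(x,r)$ with $\Theta_\mu(E,B)\ge\tau$, one has $\Theta_\mu(E,B)\le C r\,\dfrac{\mathcal{H}_h(\partial E\cap\Lambda B)}{\mu(\Lambda B)}$. *)

(* Defs.v *)
From HB Require Import structures.
From mathcomp Require Import all_boot all_order all_algebra.
From mathcomp Require Import all_classical all_reals all_analysis.

Set Implicit Arguments.
Unset Strict Implicit.
Unset Printing Implicit Defensive.

Import Order.TTheory GRing.Theory Num.Theory.
Import numFieldNormedType.Exports.

Local Open Scope classical_set_scope.
Local Open Scope ring_scope.
Local Open Scope ereal_scope.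

(* Measurable types are pointed in MathComp-Analysis, so a metric space that is
   to carry a Borel sigma-algebra has to be pointed, that is, nonempty. *)
#[short(type="pmetricType")]
HB.structure Definition PointedMetric (K : numDomainType) :=
  { T of Pointed T & Metric K T }.

Notation borelType T := (g_sigma_algebraType (@open T)).

Section metric_measure.
Context {R : realType} {T : pmetricType R}.
Implicit Types (mu : {measure set (borelType T) -> \bar R}) (E F : set T).
Implicit Types (x : T) (r : R).

Definition borel E := <<s @open T >> E.

Definition diam : \bar R :=
  ereal_sup [set (mdist p.1 p.2)%:E | p in [set: T * T]].

Definition boundary E : set T := closure E `\` E°.

Definition radon mu :=
  [/\ forall K : set T, compact K -> mu K < +oo,
      forall A : set T, borel A ->
        mu A = ereal_inf [set mu U | U in [set U : set T | open U /\ A `<=` U]]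
    & forall U : set T, open U ->
        mu U = ereal_sup [set mu K | K in [set K : set T | compact K /\ K `<=` U]]].

Definition supp mu : set T :=
  [set x | forall U : set T, open U -> U x -> 0 < mu U].

Definition metric_measure_space mu :=
  [/\ radon mu,
      supp mu = setT
    & forall x r, (0 < r)%R -> 0 < mu (ball x r) < +oo].

Definition doubling mu (D : R) :=
  forall x r, (0 < r)%R -> r%:E < diam ->
    0 < mu (ball x (2 * r)%R) <= D%:E * mu (ball x r).

Definition Theta mu E F : \bar R :=
  mine (mu (E `&` F)) (mu (F `\` E)) / mu F.

Definition codim1 mu x r : \bar R := r^-1%:E * mu (ball x r).

(* Coverings are indexed by a subset of nat, so that finite (and empty)
   coverings are allowed: each ball of a covering has positive radius, hence
   positive weight, and infinite sequences alone would give larger values. *)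
Definition hausdorff_delta mu (delta : R) E : \bar R :=
  ereal_inf [set v | exists (I : set nat) (c : nat -> T) (r : nat -> R),
    [/\ forall i, I i -> (0 < r i <= delta)%R,
        E `<=` \bigcup_(i in I) ball (c i) (r i)
      & v = \esum_(i in I) codim1 mu (c i) (r i)]].

Definition hausdorff mu E : \bar R :=
  lim (hausdorff_delta mu delta E @[delta --> (0 : R)%R^'+]).

Definition isoperimetric mu (tau C Lambda : R) :=
  forall E, borel E -> forall x r, (0 < r)%R ->
    tau%:E <= Theta mu E (ball x r) ->
    Theta mu E (ball x r) <=
      C%:E * r%:E * (hausdorff mu (boundary E `&` ball x (Lambda * r)%R)
                     / mu (ball x (Lambda * r)%R)).

Definition relative_isoperimetric mu (C Lambda : R) :=
  forall x r, (0 < r)%R -> forall E, borel E ->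
    Theta mu E (ball x r) <=
      C%:E * r%:E * (hausdorff mu (boundary E `&` ball x (Lambda * r)%R)
                     / mu (ball x (Lambda * r)%R)).

Definition log2 (a : R) : R := (ln a / ln 2)%R.

End metric_measure.

Arguments diam {R} T.

(* Main.v *)
Require Import Defs.
From mathcomp Require Import all_boot all_order all_algebra.
From mathcomp Require Import all_classical all_reals all_analysis.
From mathcomp Require Import ring lra.

(* Suppose that E has small density in B and in 2B (otherwise the hypothesis,
   applied to B or to 2B, gives the claim at once) and, up to exchanging E with
   its complement, that E is the small part of B. Around a point y of E in B,
   the density of E in B(y, r) is then at most 1/D. Halving the radius until
   the density first exceeds 1/D, the previous ball B(y, s) has
   Theta >= 1/D^2, and the hypothesis bounds mu(B(y, Lambda s)) by
   D^2 C r H(boundary E in B(y, Lambda s)). If the density never exceeds 1/D,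
   then most of every small ball B(y, 2^-k r) lies in U \ E, where U is an open
   neighbourhood of E in B with mu(U \ E) arbitrarily small; this replaces the
   Lebesgue differentiation theorem. Inner regularity leaves finitely many
   such balls to cover E in B, and a greedy selection extracts balls at
   positive distance from one another whose 4-fold dilates still cover. On such
   balls the Hausdorff measure is superadditive because it is a metric outer
   measure. *)

Set Implicit Arguments.
Unset Strict Implicit.
Unset Printing Implicit Defensive.

Import Order.TTheory GRing.Theory Num.Theory.
Import numFieldNormedType.Exports.

Local Open Scope classical_set_scope.
Local Open Scope ring_scope.

(** * Balls in a metric space and the selection of separated balls *)

Section metric.
Context {R : realType} {T : pmetricType R}.
Implicit Types (x y z : T) (r s : R).

Lemma ballP x r y : ball x r y <-> mdist x y < r.
Proof. by rewrite ballEmdist. Qed.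

Lemma ball_sub x y r s : mdist x y + r <= s -> ball y r `<=` ball x s.
Proof.
move=> xyrs z /ballP yz; apply/ballP.
by rewrite (le_lt_trans (metric_triangle x y z))// (lt_le_trans _ xyrs)// ltrD2l.
Qed.

Lemma open_mball x r : open (ball x r).
Proof.
rewrite openE => y /ballP xy.
apply/nbhs_ballP; exists (r - mdist x y) => /=; first by rewrite subr_gt0.
by apply: ball_sub; rewrite addrC subrK.
Qed.

(* Greedy selection: run through the balls by increasing radius from the end of
   the list and drop a ball as soon as it is too close to a selected one. *)
Lemma separated_subcover (rho : T -> R) (s : seq T) :
  (forall x, x \in s -> 0 < rho x) ->
  exists t : seq T, [/\ {subset t <= s},
    pairwise (fun x y => 3 / 2 * (rho x + rho y) <= mdist x y) t &
    forall x, x \in s -> exists2 y, y \in t & ball x (rho x) `<=` ball y (4 * rho y)].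
Proof.
pose e x y := rho x <= rho y.
have e_total : total e by move=> x y; exact: le_total.
have e_trans : transitive e by move=> y x z; exact: le_trans.
wlog : s / sorted e s => [|es rho0].
  move=> /(_ (sort e s) (sort_sorted e_total s)) + rho0.
  case=> [x|t [ts tsep tcov]]; first by rewrite mem_sort => /rho0.
  exists t; split => // [x /ts|x xs]; first by rewrite mem_sort.
  by apply: tcov; rewrite mem_sort.
elim: s es rho0 => [_ _|x s IH]; first by exists [::].
rewrite /= (path_sortedE e_trans) => /andP[/allP xs es] rho0.
have [y ys|t [ts tsep tcov]] := IH es.
  by apply: rho0; rewrite in_cons ys orbT.
have x0 : 0 < rho x by apply: rho0; rewrite mem_head.
have [far|/allPn[y yt]] :=
    boolP (all (fun y => 3 / 2 * (rho x + rho y) <= mdist x y) t).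
- exists (x :: t); split.
  + by move=> y; rewrite !in_cons => /orP[->//|/ts ->]; rewrite orbT.
  + by rewrite /= far.
  + move=> y; rewrite in_cons => /orP[/eqP ->|/tcov[z zt yz]].
      exists x; first exact: mem_head.
      by apply: le_ball; lra.
    by exists z => //; rewrite in_cons zt orbT.
(* Since [rho x <= rho y], closeness gives [mdist x y + rho x < 3 * rho y + rho y]: the factor 3/2
   leads to the dilation 4, that is, two doublings. *)
- rewrite -ltNge => xy; exists t; split => //.
  + by move=> z /ts zs; rewrite in_cons zs orbT.
  + move=> z; rewrite in_cons => /orP[/eqP ->|/tcov//].
    exists y => //; apply: ball_sub; rewrite metric_sym.
    by have := xs _ (ts _ yt); rewrite /e; lra.
Qed.

End metric.


(** * Codimension-one Hausdorff measure and its superadditivity on separated sets *)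

Section hausdorff_measure.
Context {R : realType} {T : pmetricType R}.
Variable mu : {measure set (borelType T) -> \bar R}.
Implicit Types (A P Q : set T) (d : R).
Local Open Scope ereal_scope.

Lemma codim1_ge0 x r : (0 < r)%R -> 0 <= codim1 mu x r.
Proof. by move=> r0; rewrite mule_ge0// lee_fin invr_ge0 ltW. Qed.

Lemma hausdorff_delta_ge0 d A : 0 <= hausdorff_delta mu d A.
Proof.
apply/ereal_infP => _ [I [c [r [r0 _ ->]]]].
by apply: esum_ge0 => i /r0/andP[ri _]; exact: codim1_ge0.
Qed.

Lemma hausdorff_delta_le d P Q : P `<=` Q ->
  hausdorff_delta mu d P <= hausdorff_delta mu d Q.
Proof.
move=> PQ; apply: ereal_inf_le_tmp => _ [I [c [r [r0 QI ->]]]].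
by exists I, c, r; split => //; exact: subset_trans QI.
Qed.

(** A smaller [d] admits fewer coverings, so the infimum grows as [d] decreases; the [lim] in
    [hausdorff] is thus a genuine limit. *)
Lemma is_cvg_hausdorff_delta A :
  cvg (hausdorff_delta mu d A @[d --> (0 : R)%R^'+]).
Proof.
apply: nonincreasing_at_right_is_cvge; near=> b => d1 d2 _ _ d12.
apply: ereal_inf_le_tmp => _ [I [c [r [r0 AI ->]]]].
exists I, c, r; split => // i /r0/andP[-> rd] /=; exact: le_trans rd d12.
Unshelve. all: by end_near. Qed.

Lemma hausdorff_ge0 A : 0 <= hausdorff mu A.
Proof.
apply: lime_ge; first exact: is_cvg_hausdorff_delta.
by near=> d; exact: hausdorff_delta_ge0.
Unshelve. all: by end_near. Qed.

Lemma hausdorff_le P Q : P `<=` Q -> hausdorff mu P <= hausdorff mu Q.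
Proof.
move=> PQ; apply: lee_lim; [exact: is_cvg_hausdorff_delta..|].
by near=> d; exact: hausdorff_delta_le.
Unshelve. all: by end_near. Qed.

(* Balls of radius at most half the distance between P and Q meet only one of
   them, so a fine covering of the union splits into two coverings. *)
Lemma hausdorffU_separated d P Q : (0 < d)%R ->
  (forall x y, P x -> Q y -> (d <= mdist x y)%R) ->
  hausdorff mu P + hausdorff mu Q <= hausdorff mu (P `|` Q).
Proof.
move=> d0 dPQ; rewrite /hausdorff -limeD//; last first.
- by apply: ge0_adde_def; rewrite inE hausdorff_ge0.
- exact: is_cvg_hausdorff_delta.
- exact: is_cvg_hausdorff_delta.
apply: lee_lim; last 2 first.
- exact: is_cvg_hausdorff_delta.
- near=> e; apply/ereal_infP => _ [I [c [r [r0 PQI ->]]]].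
  pose B := [set i | (ball (c i) (r i) `&` P) !=set0].
  rewrite (esumID B); last by move=> i /r0/andP[ri _]; exact: codim1_ge0.
  apply: leeD.
  + apply: ge_ereal_inf; eexists; last exact: lexx.
    exists (I `&` B), c, r; split => // [i [/r0]//|x Px].
    have [i Ii ix] := PQI x (or_introl Px).
    by exists i => //; split => //; exists x.
  + apply: ge_ereal_inf; eexists; last exact: lexx.
    exists (I `&` ~` B), c, r; split => // [i [/r0]//|y Qy].
    have [i Ii /= /ballP iy] := PQI y (or_intror Qy).
    exists i; last exact/ballP.
    split=> // -[x [/ballP ix Px]].
    have /andP[_ re] := r0 _ Ii.
    have := dPQ x y Px Qy; have := metric_triangle x (c i) y.
    have : (e < d / 2)%R by near: e; apply: nbhs_right_lt; lra.
    rewrite (metric_sym x (c i)); lra.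
- apply: is_cvgeD; [|exact: is_cvg_hausdorff_delta..].
  by apply: ge0_adde_def; rewrite inE hausdorff_ge0.
Unshelve. all: by end_near. Qed.

Lemma hausdorff_sum_separated A (rho : T -> R) (t : seq T) :
  (forall x, x \in t -> (0 < rho x)%R) ->
  pairwise (fun x y => 3 / 2 * (rho x + rho y) <= mdist x y)%R t ->
  \sum_(x <- t) hausdorff mu (A `&` ball x (rho x)) <=
  hausdorff mu (A `&` [set z | exists2 x, x \in t & ball x (rho x) z]).
Proof.
elim: t => [_ _|x t IH rho0]; first by rewrite big_nil hausdorff_ge0.
rewrite big_cons /= => /andP[/allP xt tt].
have x0 : (0 < rho x)%R by apply: rho0; rewrite mem_head.
have t0 y : y \in t -> (0 < rho y)%R.
  by move=> yt; apply: rho0; rewrite in_cons yt orbT.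
apply: (le_trans (leeD (lexx _) (IH t0 tt))).
(* Points of the balls at [x] and [y] are at least [(rho x + rho y) / 2] apart; the bound
   [rho x / 2] is uniform over all later balls. *)
apply: (le_trans (hausdorffU_separated (d := rho x / 2) _ _)) => [|u v|].
- lra.
- move=> [_ /ballP xu] [_ [y yt /ballP yv]].
  have := xt _ yt; have := t0 _ yt.
  have := metric_triangle x u y; have := metric_triangle u v y.
  rewrite (metric_sym v y); lra.
- apply: hausdorff_le => z [[Az xz]|[Az [y yt yz]]]; split=> //.
    by exists x => //; rewrite mem_head.
  by exists y => //; rewrite in_cons yt orbT.
Qed.

End hausdorff_measure.

(** * Borel measurability, finite sums of measures and regularity *)

Section borel_measure.
Context {R : realType} {T : pmetricType R}.
Variable mu : {measure set (borelType T) -> \bar R}.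
Implicit Types (A B U V K : set (borelType T)) (x y : T) (r : R).
Local Open Scope ereal_scope.

Lemma open_borel (U : set T) : open U -> measurable (U : set (borelType T)).
Proof. by move=> oU; exact: sub_sigma_algebra. Qed.

Lemma ball_measurable x r : measurable (ball x r : set (borelType T)).
Proof. by apply: open_borel; exact: open_mball. Qed.

Lemma compact_measurable (K : set T) :
  compact K -> measurable (K : set (borelType T)).
Proof.
move=> cK; rewrite -(setCK K); apply: measurableC; apply: open_borel.
by rewrite openC; exact: compact_closed (@metric_hausdorff _ _) cK.
Qed.

Lemma measure_le_sum_seq (F : T -> set (borelType T)) A (t : seq T) :
  (forall x, measurable (F x)) -> measurable A ->
  A `<=` [set z | exists2 x, x \in t & F x z] ->
  mu A <= \sum_(x <- t) mu (F x).
Proof.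
move=> mF; elim: t A => [A _ A0|x t IH A mA AF].
  rewrite (_ : A = set0) ?measure0 ?big_nil//.
  by rewrite -subset0 => z /A0[].
rewrite big_cons (measureDI mu mA (mF x)) addeC; apply: leeD.
  by apply: le_measure; rewrite ?inE//; exact: measurableI.
apply: IH; first exact: measurableD.
move=> z [/AF[y]]; rewrite in_cons => /orP[/eqP ->//|yt yz _].
by exists y.
Qed.

Lemma sum_seq_measure_le (rho : T -> R) A (t : seq T) : measurable A ->
  (forall x, x \in t -> (0 < rho x)%R) ->
  pairwise (fun x y => 3 / 2 * (rho x + rho y) <= mdist x y)%R t ->
  \sum_(x <- t) mu (ball x (rho x) `&` A) <= mu A.
Proof.
elim: t A => [|x t IH] A mA rho0; first by rewrite big_nil measure_ge0.
rewrite big_cons /= => /andP[/allP xt tt].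
have x0 : (0 < rho x)%R by apply: rho0; rewrite mem_head.
have t0 y : y \in t -> (0 < rho y)%R.
  by move=> yt; apply: rho0; rewrite in_cons yt orbT.
rewrite (measureDI mu mA (ball_measurable x (rho x))) addeC (setIC A); apply: leeD => //.
apply: le_trans (IH _ _ t0 tt).
  rewrite big_seq [leRHS]big_seq; apply: lee_sum => y yt.
  (* Separated balls are disjoint, so removing the head ball from [A] does not change the other
     traces. *)
  rewrite (_ : _ `&` (A `\` _) = ball y (rho y) `&` A)//.
  apply/seteqP; split => [z [? []]//|z [yz Az]]; do 2 split => //.
  move=> /= /ballP xz; move/ballP : yz => yz.
  have := xt _ yt; have := metric_triangle x z y; have := t0 _ yt.
  by rewrite (metric_sym z y); lra.
by apply: measurableD => //; exact: ball_measurable.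
Qed.

Hypothesis mu_mms : metric_measure_space mu.

Lemma ball_fin_num x r : (0 < r)%R -> mu (ball x r) \is a fin_num.
Proof.
case: mu_mms => _ _ h r0; have /andP[_ fin] := h x r r0.
by rewrite ge0_fin_numE// measure_ge0.
Qed.

Lemma sub_ball_fin_num A x r : measurable A -> (0 < r)%R -> A `<=` ball x r ->
  mu A \is a fin_num.
Proof.
move=> mA r0 Ar; rewrite ge0_fin_numE ?measure_ge0//.
have := ball_fin_num x r0; rewrite ge0_fin_numE ?measure_ge0//.
by apply: le_lt_trans; apply: le_measure; rewrite ?inE//; exact: ball_measurable.
Qed.

Lemma outer_approx A (e : R) : measurable A -> mu A \is a fin_num ->
  (0 < e)%R ->
  exists2 U : set T, open U & A `<=` U /\ mu (U `\` A) <= e%:E.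
Proof.
move=> mA Afin e0; case: mu_mms => -[_ outer _] _ _.
have := outer _ mA => muA; rewrite muA in Afin.
have [_ [U [oU AU] <-]] := lb_ereal_inf_adherent e0 Afin.
rewrite -muA => /ltW Ue; rewrite -muA in Afin.
have mU := open_borel oU.
exists U => //; split => //.
move: Ue; rewrite (measureDI mu mU mA) (_ : U `&` A = A); last first.
  by rewrite setIC; exact/setIidl.
by rewrite addeC leeD2lE.
Qed.

(** Inner regularity is given for open sets. A compact subset of [A] is obtained from a compact set
    nearly filling the ball by removing an open [W] that barely exceeds the ball minus [A]. *)
Lemma inner_outer_approx A x r (e : R) : measurable A -> (0 < r)%R ->
  A `<=` ball x r -> (0 < e)%R ->
  exists K U : set T, [/\ compact K, open U, K `<=` A /\ A `<=` U,
    U `<=` ball x r & mu (A `\` K) <= e%:E /\ mu (U `\` A) <= e%:E].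
Proof.
move=> mA r0 Ar e0; have mB := ball_measurable x r.
have [U oU [AU UA]] := outer_approx mA (sub_ball_fin_num mA r0 Ar) e0.
have e20 : (0 < e / 2)%R by rewrite divr_gt0.
have mBA : measurable (ball x r `\` A : set (borelType T)) by exact: measurableD.
have [W oW [BW WB]] := outer_approx mBA
  (sub_ball_fin_num mBA r0 (@subDsetl _ _ _)) e20.
have Bfin := ball_fin_num x r0.
have [K cK [KB KBe]] : exists2 K : set T, compact K &
    K `<=` ball x r /\ mu (ball x r `\` K) <= (e / 2)%:E.
  case: mu_mms => -[_ _ inner] _ _.
  have := inner _ (open_mball x r) => muB.
  have supfin := Bfin; rewrite muB in supfin.
  have [_ [K [cK KB] <-]] := ub_ereal_sup_adherent e20 supfin.
  rewrite -muB => /ltW KBe; exists K => //; split => //.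
  have mK := compact_measurable cK.
  have Kfin := sub_ball_fin_num mK r0 KB.
  rewrite measureD//; last by rewrite -ge0_fin_numE// measure_ge0.
  rewrite (_ : _ `&` K = K); last by rewrite setIC; exact/setIidl.
  rewrite leeBlDr//.
  by move: KBe; rewrite leeBlDr// addeC.
have cKW : compact (K `&` ~` W).
  by apply: compact_closedI => //; exact: open_closedC.
have mKW := compact_measurable cKW.
have mK := compact_measurable cK.
have mW := open_borel oW.
exists (K `&` ~` W), (U `&` ball x r); split => //.
- exact/openI/open_mball.
- split=> [z [Kz Wz]|z Az]; last by split; [exact: AU | exact: Ar].
  by apply: contrapT => Az; apply: Wz; apply: BW; split => //; exact: KB.
- split.
    have -> : e = (e / 2 + e / 2)%R by lra.
    rewrite EFinD; apply: le_trans (leeD KBe WB).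
    apply: le_trans (measureU2 mu _ _); last 2 first.
    + exact: measurableD.
    + exact: measurableD.
    apply: le_measure; rewrite ?inE; first exact: measurableD.
    + by apply: measurableU; exact: measurableD.
    (* A lost point of [A] misses [K] or lies in the excess of [W]; each part has measure at most
       [e / 2]. *)
    + move=> z [Az KWz]; have [Kz|Kz] := pselect (K z); [right|left].
      * split; last by case.
        by apply: contrapT => Wz; exact: KWz.
      * by split => //; exact: Ar.
  apply: le_trans UA; apply: le_measure; rewrite ?inE.
  + by apply: measurableD => //; apply: measurableI => //; exact: open_borel.
  + by apply: measurableD => //; exact: open_borel.
  + by move=> z [[]].
Qed.

End borel_measure.

(** * Doubling estimates and the covering argument *)

Section doubling.
Context {R : realType} {T : pmetricType R}.
Variable mu : {measure set (borelType T) -> \bar R}.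
Hypothesis mu_mms : metric_measure_space mu.
Variable D : R.
Hypothesis D_ge2 : 2 <= D.
Hypothesis muD : doubling mu D.
Implicit Types (A Z W : set T) (x y : T) (r : R).

Definition ball_mass x r : R := fine (mu (ball x r)).

Lemma ball_massE x r : 0 < r -> mu (ball x r) = (ball_mass x r)%:E.
Proof. by move=> r0; rewrite fineK// ball_fin_num. Qed.

Lemma ball_mass_gt0 x r : 0 < r -> 0 < ball_mass x r.
Proof.
move=> r0; rewrite -lte_fin -ball_massE//.
by case: mu_mms => _ _ /(_ x r r0)/andP[].
Qed.

Lemma ball_mass_le x y r s : 0 < r -> 0 < s -> ball x r `<=` ball y s ->
  ball_mass x r <= ball_mass y s.
Proof.
move=> r0 s0 xy; rewrite -lee_fin -!ball_massE//.
by apply: le_measure; rewrite ?inE//; exact: ball_measurable.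
Qed.

(* The doubling hypothesis only concerns radii below the diameter; past the
   diameter the ball of radius 2/3 diam already doubles to the whole space. *)
Lemma ball_mass_double x r : 0 < r -> ball_mass x (2 * r) <= D * ball_mass x r.
Proof.
move=> r0; have r20 : 0 < 2 * r by rewrite mulr_gt0.
have [rdiam|diamr] := ltP r%:E (diam T).
  by have /andP[_] := muD x r0 rdiam; rewrite !ball_massE// -EFinM lee_fin.
have dist_diam y z : ((mdist y z)%:E <= diam T)%E.
  by apply: ereal_sup_ubound; exists (y, z).
have diam_fin : diam T \is a fin_num.
  rewrite ge0_fin_numE; first by rewrite (le_lt_trans diamr)// ltry.
  by apply: le_trans (dist_diam x x); rewrite lee_fin mdist_ge0.
pose d := fine (diam T); have dE : diam T = d%:E by rewrite fineK.
have dist_d y z : mdist y z <= d by rewrite -lee_fin -dE.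
have {diamr}dr : d <= r by rewrite -lee_fin -dE.
(* Diameter zero means a one-point space, where all balls coincide. *)
have [d0|d0] := leP d 0.
  rewrite (_ : ball_mass x (2 * r) = ball_mass x r).
    by have := ball_mass_gt0 x r0; have := D_ge2; nra.
  have full s : 0 < s -> ball x s = setT.
    move=> s0; apply/seteqP; split => // y _; apply/ballP.
    by have := dist_d x y; lra.
  by rewrite /ball_mass !full.
have s0 : 0 < 2 / 3 * d by lra.
have sr : ball_mass x (2 / 3 * d) <= ball_mass x r.
  by apply: ball_mass_le => //; apply: le_ball; lra.
have sd : ((2 / 3 * d)%:E < diam T)%E by rewrite dE lte_fin; lra.
have /andP[_] := muD x s0 sd.
rewrite !ball_massE -?EFinM ?lee_fin//; last by lra.
move=> sD; apply: (@le_trans _ _ (ball_mass x (2 * (2 / 3 * d)))).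
  apply: ball_mass_le; [lra|lra|] => y _; apply/ballP.
  by have := dist_d x y; lra.
by apply: le_trans sD _; rewrite ler_pM2l//; have := D_ge2; lra.
Qed.

Lemma ball_mass_double_iter n x r : 0 < r ->
  ball_mass x (2 ^+ n * r) <= D ^+ n * ball_mass x r.
Proof.
move=> r0; elim: n => [|n IH]; first by rewrite !expr0 !mul1r.
rewrite !exprS -!mulrA; apply: le_trans (ball_mass_double _ _) _.
  by rewrite mulr_gt0// exprn_gt0.
by rewrite ler_pM2l//; have := D_ge2; lra.
Qed.

Lemma ball_mass_dilate L x r : 1 <= L -> 0 < r ->
  ball_mass x (2 * L * r) <= D `^ (2 + log2 L) * ball_mass x r.
Proof.
move=> L1 r0; have L0 : 0 < L by lra.
have ln20 : 0 < ln 2 :> R by apply: ln_gt0; lra.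
have lL0 : 0 <= log2 L by rewrite divr_ge0 ?ln_ge0//; lra.
have D0 : 0 <= D by have := D_ge2; lra.
(* With [n] the integer part of [log2 L], [2 * L <= 2 ^+ n.+2], and [n + 2] doublings cost at most
   the power [2 + log2 L] of [D]. *)
have [n /andP[nl ln1]] : exists n : nat, n%:R <= log2 L < n.+1%:R.
  by exists (Num.truncn (log2 L)); exact: truncn_itv.
have L2n : L <= 2 ^+ n.+1.
  rewrite -ler_ln ?posrE ?exprn_gt0// lnXn//.
  by move: ln1; rewrite ltr_pdivrMr// mulr_natl => /ltW.
apply: (@le_trans _ _ (ball_mass x (2 ^+ n.+2 * r))).
  apply: ball_mass_le; [by rewrite !mulr_gt0|by rewrite mulr_gt0// exprn_gt0|].
  by apply: le_ball; rewrite ler_pM2r// exprS ler_pM2l.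
apply: le_trans (ball_mass_double_iter _ _ r0) _.
apply: ler_wpM2r; first by apply: ltW; exact: ball_mass_gt0.
rewrite -(powR_mulrn n.+2 D0).
by apply: ler_powR; [have := D_ge2; lra | rewrite -natr1 -natr1; lra].
Qed.

(* The local estimate has an error term supported on the part of the
   ball lying in [U `\` A], a set of arbitrarily small measure. *)
Lemma covering_estimate A Z W x0 r (a b : R) : 0 < r -> 0 <= a -> 0 <= b ->
  borel A -> A `<=` ball x0 r ->
  (forall U, open U -> A `<=` U -> U `<=` ball x0 r ->
    forall y, A y -> exists2 rho, 0 < rho & ball y rho `<=` W /\
      (mu (ball y rho) <= a%:E * hausdorff mu (Z `&` ball y rho) +
                          b%:E * mu (ball y rho `&` (U `\` A)))%E) ->
  (mu A <= (D ^+ 2 * a)%:E * hausdorff mu (Z `&` W))%E.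
Proof.
move=> r0 a0 b0 mA Ar loc; have D20 : 0 <= D ^+ 2 by rewrite exprn_ge0//; have := D_ge2; lra.
apply/lee_addgt0Pr => e e0.
(* The part of [A] outside [K] costs [e'], the error terms cost [D ^+ 2 * b * e']; together they
   make [e]. *)
pose e' := e / (D ^+ 2 * b + 1).
have c0 : 0 < D ^+ 2 * b + 1 by rewrite ltr_wpDl// mulr_ge0.
have e'0 : 0 < e' by rewrite divr_gt0.
have [K [U [cK oU [KA AU] Ur [AK UA]]]] := inner_outer_approx mu_mms mA r0 Ar e'0.
have mU := open_borel oU; have mK := compact_measurable cK.
have mUA : measurable (U `\` A : set (borelType T)) by exact: measurableD.
have /choice[rho rhoP] : forall y, exists rho, A y -> 0 < rho /\
    ball y rho `<=` W /\
      (mu (ball y rho) <= a%:E * hausdorff mu (Z `&` ball y rho) +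
                          b%:E * mu (ball y rho `&` (U `\` A)))%E.
  (* Outside [A] the radius takes the default 0; all centres selected below lie in [K], hence in
     [A]. *)
  move=> y; have [Ay|nAy] := pselect (A y); last by exists 0.
  by have [rho rho0 rhoP] := loc U oU AU Ur y Ay; exists rho.
have : finite_subset_cover K (fun y => ball y (rho y)) K.
  move: cK; rewrite compact_cover => cK; apply: cK => [y _|y Ky].
    exact: open_mball.
  by exists y => //; apply: ballxx; have [] := rhoP _ (KA _ Ky).
move=> [F FK KF].
have F0 y : y \in finmap.enum_fset F -> A y.
  by move=> yF; apply: KA; apply/set_mem/FK.
have [t [tF tsep tcov]] := @separated_subcover _ _ rho (finmap.enum_fset F)
  (fun y yF => (rhoP _ (F0 _ yF)).1).
have t0 y : y \in t -> 0 < rho y by move=> /tF/F0/rhoP[].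
have Kt : (mu K <= (D ^+ 2)%:E * \sum_(y <- t) mu (ball y (rho y)))%E.
  have Kcov : K `<=` [set z | exists2 y, y \in t & ball y (4 * rho y) z].
    by move=> z /KF[y /= /tcov[w wt yw] yz]; exists w => //; exact: yw.
  apply: (le_trans (measure_le_sum_seq mu
    (fun y => ball_measurable y (4 * rho y)) mK Kcov)).
  rewrite ge0_sume_distrr; last by move=> *; exact: measure_ge0.
  rewrite big_seq [leRHS]big_seq; apply: lee_sum => y /t0 y0.
  rewrite !ball_massE ?mulr_gt0// -EFinM lee_fin.
  by have := ball_mass_double_iter 2 y y0; rewrite (_ : 2 ^+ 2 = 4 :> R)//; ring.
(* Summing the local estimates: the Hausdorff terms combine by superadditivity, the error terms by
   disjointness inside [U] minus [A]. *)
have sumt : (\sum_(y <- t) mu (ball y (rho y)) <=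
    a%:E * hausdorff mu (Z `&` W) + b%:E * e'%:E)%E.
  apply: (@le_trans _ _ (\sum_(y <- t)
      (a%:E * hausdorff mu (Z `&` ball y (rho y)) +
       b%:E * mu (ball y (rho y) `&` (U `\` A))))%E).
    by rewrite big_seq [leRHS]big_seq; apply: lee_sum => y /tF/F0/rhoP[_ []].
  rewrite big_split /= -ge0_sume_distrr -?ge0_sume_distrr; last 2 first.
  - by move=> *; exact: measure_ge0.
  - by move=> *; exact: hausdorff_ge0.
  apply: leeD; apply: lee_wpmul2l; rewrite ?lee_fin//.
    apply: le_trans (hausdorff_sum_separated mu Z t0 tsep) _.
    apply: hausdorff_le => z [Zz [y yt yz]]; split => //.
    by have [_ [yW _]] := rhoP _ (F0 _ (tF _ yt)); exact: yW.
  exact: le_trans (sum_seq_measure_le mu mUA t0 tsep) UA.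
rewrite (measureDI mu mA mK) (_ : A `&` K = K); last first.
  by rewrite setIC; exact/setIidl.
apply: le_trans (leeD AK Kt) _.
apply: le_trans (leeD (lexx _) (lee_wpmul2l _ sumt)) _; first by rewrite lee_fin.
rewrite ge0_muleDr ?mule_ge0 ?hausdorff_ge0 ?lee_fin ?(ltW e'0)//.
rewrite addeCA muleA -EFinM leeD2l// -!EFinM -EFinD lee_fin.
have -> : e = e' * (D ^+ 2 * b + 1) by rewrite divfK// gt_eqF.
by rewrite le_eqVlt; apply/orP; left; apply/eqP; ring.
Qed.

End doubling.

(** Permits exchanging [E] with its complement. *)
Lemma boundaryC {R : realType} {T : pmetricType R} (E : set T) :
  boundary (~` E) = boundary E.
Proof. by rewrite /boundary closure_setC interiorC !setDE setCK setIC. Qed.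

(** Shared bookkeeping: [k] is the cost of passing from [w] to [v], and [h'] belongs to a larger
    ball. *)
Lemma lee_mul_trans {R : realType} (k c c' v w : R) (h h' : \bar R) :
  0 <= k -> 0 <= c -> (0 <= h)%E -> v <= k * w -> (w%:E <= c%:E * h)%E ->
  (h <= h')%E -> k * c <= c' -> (v%:E <= c'%:E * h')%E.
Proof.
move=> k0 c0 h0 vkw wch hh' kcc'.
apply: (@le_trans _ _ (k * w)%:E); first by rewrite lee_fin.
rewrite EFinM; apply: (@le_trans _ _ (k%:E * (c%:E * h))%E).
  by apply: lee_wpmul2l => //; rewrite lee_fin.
by rewrite muleA -EFinM; apply: lee_pmul => //; rewrite ?lee_fin ?mulr_ge0.
Qed.

(** * From the isoperimetric inequality at scale [tau] to the relative one *)

Section isoperimetric.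
Context {R : realType} {T : pmetricType R}.
Variable mu : {measure set (borelType T) -> \bar R}.
Hypothesis mu_mms : metric_measure_space mu.
Variables D tau C Lambda : R.
Hypothesis D_ge2 : 2 <= D.
Hypothesis muD : doubling mu D.
Hypothesis tau_le : tau <= D ^- 3.
Hypothesis C_gt0 : 0 < C.
Hypothesis Lambda_ge1 : 1 <= Lambda.
Hypothesis iso : isoperimetric mu tau C Lambda.
Implicit Types (E : set T) (x y : T) (r s : R).

Definition mass_in E x r : R := fine (mu (E `&` ball x r)).

Local Notation m := (ball_mass mu).
Local Notation H := (hausdorff mu).

Lemma borelI_ball E x r : borel E -> borel (E `&` ball x r).
Proof. by move=> mE; apply: (@measurableI _ (borelType T)) => //; exact: ball_measurable. Qed.

Lemma borelC E : borel E -> borel (~` E).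
Proof. by move=> mE; exact: (@measurableC _ (borelType T)). Qed.

Lemma mass_inE E x r : borel E -> 0 < r -> mu (E `&` ball x r) = (mass_in E x r)%:E.
Proof.
move=> mE r0; rewrite fineK//.
by apply: (sub_ball_fin_num mu_mms (borelI_ball x r mE) r0); exact: subIsetr.
Qed.

Lemma mass_in_ge0 E x r : 0 <= mass_in E x r.
Proof. by rewrite fine_ge0. Qed.

Lemma mass_in_le E x y r s : borel E -> 0 < r -> 0 < s ->
  ball x r `<=` ball y s -> mass_in E x r <= mass_in E y s.
Proof.
move=> mE r0 s0 xy; rewrite -lee_fin -!mass_inE//.
by apply: le_measure; rewrite ?inE; [exact: borelI_ball..|exact: setIS].
Qed.

Lemma mass_inC E x r : borel E -> 0 < r ->
  mass_in E x r + mass_in (~` E) x r = m x r.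
Proof.
move=> mE r0; apply: EFin_inj; rewrite EFinD -ball_massE// -!mass_inE//; last exact: borelC.
rewrite (measureDI mu (ball_measurable x r) mE) setDE addeC.
by rewrite (setIC E) (setIC (~` E)).
Qed.

Lemma ThetaE E x r : borel E -> 0 < r ->
  Theta mu E (ball x r) =
  (Num.min (mass_in E x r) (mass_in (~` E) x r) / m x r)%:E.
Proof.
move=> mE r0; rewrite /Theta setDE (setIC (ball x r)) ball_massE//.
rewrite !mass_inE//; last exact: borelC.
by rewrite inver gt_eqF ?ball_mass_gt0// -EFin_min -EFinM.
Qed.

(** The two density bounds say [t <= Theta], so the hypothesis applies and bounds [t] itself;
    clearing the denominator gives the claim. *)
Lemma iso_mass E x r (t : R) : borel E -> 0 < r -> tau <= t ->
  t * m x r <= mass_in E x r -> t * m x r <= mass_in (~` E) x r ->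
  ((t * m x (Lambda * r))%:E <=
   (C * r)%:E * H (boundary E `&` ball x (Lambda * r)))%E.
Proof.
move=> mE r0 taut inE outE; have L1 := Lambda_ge1.
have Lr0 : 0 < Lambda * r by rewrite mulr_gt0//; lra.
have tTheta : (t%:E <= Theta mu E (ball x r))%E.
  by rewrite ThetaE// lee_fin ler_pdivlMr ?ball_mass_gt0// le_min inE.
have tauTheta := le_trans (_ : (tau%:E <= t%:E)%E) tTheta.
have := le_trans tTheta (iso mE r0 (tauTheta _)); rewrite lee_fin => /(_ taut).
rewrite (ball_massE mu_mms)// inver gt_eqF ?ball_mass_gt0// muleA.
by rewrite lee_pdivlMr ?ball_mass_gt0// -!EFinM.
Qed.

(** The two summands serve two alternatives: the Hausdorff term if halving the radius stops, the
    error term if it never does. *)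
Lemma local_estimate E x r : borel E -> 0 < r ->
  mass_in E x (2 * r) <= D ^- 3 * m x (2 * r) ->
  forall U, open U -> E `&` ball x r `<=` U -> U `<=` ball x r ->
  forall y, (E `&` ball x r) y ->
  exists2 rho, 0 < rho & ball y rho `<=` ball x (2 * Lambda * r) /\
    (mu (ball y rho) <=
     (D ^+ 2 * (C * r))%:E * H (boundary E `&` ball y rho) +
     2%:E * mu (ball y rho `&` (U `\` (E `&` ball x r))))%E.
Proof.
move=> mE r0 small U oU EU Ur y [Ey /ballP xy].
have D2 := D_ge2; have L1 := Lambda_ge1; have C0 := C_gt0.
have D0 : 0 < D by lra.
have r20 : 0 < 2 * r by lra.
have Cr0 : 0 <= D ^+ 2 * (C * r) by rewrite !mulr_ge0 ?exprn_ge0//; lra.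
have rk0 k : 0 < r / 2 ^+ k by rewrite divr_gt0// exprn_gt0.
have rkr k : r / 2 ^+ k <= r.
  by rewrite ler_pdivrMr ?exprn_gt0// ler_peMr ?(ltW r0)// exprn_ege1//; lra.
pose f k := m y (r / 2 ^+ k) < D * mass_in E y (r / 2 ^+ k).
(* [B(y,r)] lies in [B(x,2r)], which lies in [B(y,4r)]: two doublings turn the density bound
   [D ^- 3] into [1 / D]. *)
have f0 : f 0%N = false.
  apply/negbTE; rewrite /f expr0 divr1 -leNgt.
  have Ey2 : mass_in E y r <= mass_in E x (2 * r).
    by apply: mass_in_le => //; apply: ball_sub; lra.
  have x2y : m x (2 * r) <= D ^+ 2 * m y r.
    apply: le_trans (ball_mass_double_iter mu_mms D_ge2 muD 2 y r0).
    apply: ball_mass_le => //; first by rewrite mulr_gt0// exprn_gt0.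
    apply: ball_sub; rewrite metric_sym (_ : 2 ^+ 2 = 4 :> R); last by ring.
    by lra.
  have : D * mass_in E y r <= D * (D ^- 3 * (D ^+ 2 * m y r)).
    rewrite ler_pM2l//; apply: le_trans Ey2 (le_trans small _).
    by rewrite ler_pM2l// invr_gt0 exprn_gt0.
  have -> // : D * (D ^- 3 * (D ^+ 2 * m y r)) = m y r by field; lra.
have [fex|nf] := pselect (exists k, f k).
  (* The first index with [f] is a successor [k.+1]; [s] is the radius one step earlier. *)
  case: (ex_minnP fex) => -[|k]; first by rewrite f0.
  move=> fk kmin; pose s := r / 2 ^+ k.
  have s0 : 0 < s by exact: rk0.
  have sr : s <= r by exact: rkr.
  have nfk : D * mass_in E y s <= m y s.
    by rewrite leNgt; apply/negP => /kmin; rewrite ltnn.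
  have s2 : r / 2 ^+ k.+1 = s / 2 by rewrite /s exprS invfM mulrAC mulrA.
  have s20 : 0 < s / 2 by lra.
  move: fk; rewrite /f s2 => fk.
  have dbl := ball_mass_double mu_mms D_ge2 muD y s20.
  rewrite mulrC divfK// in dbl.
  have E2s : mass_in E y (s / 2) <= mass_in E y s.
    by apply: mass_in_le => //; apply: le_ball; lra.
  have ms0 := ball_mass_gt0 mu_mms y s0.
  have inout := mass_inC y mE s0.
  have D20 : 0 < D ^+ 2 by rewrite exprn_gt0.
  (* One factor [D] comes from doubling [s / 2] to [s], the other from the density above [1 / D] at
     [s / 2]. *)
  have inE : D ^- 2 * m y s <= mass_in E y s.
    by rewrite mulrC ler_pdivrMr// expr2; nra.
  (* At radius [s] the density of [E] is at most [1 / D <= 1 / 2], so the complement fills at least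
     half the ball. *)
  have outE : D ^- 2 * m y s <= mass_in (~` E) y s.
    have in0 := mass_in_ge0 E y s.
    have half : m y s <= 2 * mass_in (~` E) y s by nra.
    have DD : 2 <= D * D by nra.
    by rewrite mulrC ler_pdivrMr// expr2; nra.
  have tau2 : tau <= D ^- 2.
    apply: le_trans tau_le _; rewrite lef_pV2 ?posrE ?exprn_gt0//.
    by rewrite (exprS _ 2) ler_peMl ?(ltW D20)//; lra.
  have Ls0 : 0 < Lambda * s by rewrite mulr_gt0//; lra.
  exists (Lambda * s) => //; split.
    by apply: ball_sub; nra.
  rewrite (ball_massE mu_mms y Ls0).
  apply: (@le_trans _ _
    ((D ^+ 2 * (C * r))%:E * H (boundary E `&` ball y (Lambda * s)))%E); last first.
    by rewrite leeDl// mule_ge0// lee_fin.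
  apply: (lee_mul_trans (k := D ^+ 2) _ _ _ _ (iso_mass mE s0 tau2 inE outE) _ _).
  - by rewrite ltW.
  - by rewrite mulr_ge0// ltW.
  - exact: hausdorff_ge0.
  - by rewrite mulrA divff ?mul1r// gt_eqF.
  - exact: lexx.
  - by rewrite ler_pM2l// ler_pM2l.
have /nbhs_ballP[e /= e0 yeU] : nbhs y U.
  by apply: open_nbhs_nbhs; split => //; apply: EU; split => //; apply/ballP.
have [k ke] : exists k, r / 2 ^+ k <= e.
  exists (Num.bound (r / e)); rewrite ler_pdivrMr ?exprn_gt0//.
  by rewrite mulrC -ler_pdivrMr// ltW// upper_nthrootP.
exists (r / 2 ^+ k) => //; split.
  by apply: ball_sub; have := rkr k; nra.
have yU : ball y (r / 2 ^+ k) `<=` U by apply: subset_trans yeU; exact: le_ball.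
(* The small ball lies in [U], hence in [B(x,r)], so the error set is its part outside [E]. That is
   at least half of it, whence the factor 2. *)
rewrite (_ : _ `&` (U `\` _) = ~` E `&` ball y (r / 2 ^+ k)); last first.
  apply/seteqP; split => [z [yz [Uz nEz]]|z [nEz yz]].
    by split => // Ez; apply: nEz; split => //; exact: Ur.
  by split => //; split; [exact: yU | case].
apply: (@le_trans _ _ (2%:E * mu (~` E `&` ball y (r / 2 ^+ k)))%E); last first.
  by rewrite leeDr// mule_ge0 ?lee_fin ?hausdorff_ge0.
rewrite (mass_inE _ (borelC mE))// (ball_massE mu_mms)// -EFinM lee_fin.
have nfk : D * mass_in E y (r / 2 ^+ k) <= m y (r / 2 ^+ k).
  by rewrite leNgt; apply/negP => fk; apply: nf; exists k.
have := mass_inC y mE (rk0 k); have := mass_in_ge0 E y (r / 2 ^+ k).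
by nra.
Qed.

(** The minimum does not tell which set is small in [B(x,2r)]. The complement fills half of
    [B(x,r)], hence at least [D ^- 3] of [B(x,2r)], so it must be [E]. *)
Lemma small_mass_estimate E x r : borel E -> 0 < r ->
  mass_in E x r <= mass_in (~` E) x r ->
  Num.min (mass_in E x (2 * r)) (mass_in (~` E) x (2 * r)) < D ^- 3 * m x (2 * r) ->
  ((mass_in E x r)%:E <=
   (D ^+ 4 * (C * r))%:E * H (boundary E `&` ball x (2 * Lambda * r)))%E.
Proof.
move=> mE r0 Ehalf; have D2 := D_ge2; have C0 := C_gt0.
have r20 : 0 < 2 * r by lra.
have D0 : 0 < D by lra.
have out_big : D ^- 3 * m x (2 * r) <= mass_in (~` E) x (2 * r).
  have out2 : mass_in (~` E) x r <= mass_in (~` E) x (2 * r).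
    by apply: mass_in_le => //; [exact: borelC | apply: le_ball; lra].
  apply: le_trans out2; have := mass_inC x mE r0.
  have dbl := ball_mass_double mu_mms D_ge2 muD x r0.
  have m0 := ball_mass_gt0 mu_mms x r0.
  have D3 : 0 < D ^+ 3 by rewrite exprn_gt0.
  have : D ^- 3 * m x (2 * r) <= D ^- 3 * (D * m x r) by rewrite ler_pM2l// invr_gt0.
  have : D ^- 3 * (D * m x r) <= m x r / 2.
    rewrite mulrC ler_pdivrMr// !exprS expr0 mulr1.
    have DD : 2 <= D * D by nra.
    have Dm : 0 < D * m x r by rewrite mulr_gt0.
    by nra.
  by lra.
rewrite gt_min (le_gtF out_big) orbF => /ltW small.
(* One [D ^+ 2] comes from the covering, the other from the local estimate. *)
rewrite -mass_inE// (_ : D ^+ 4 * (C * r) = D ^+ 2 * (D ^+ 2 * (C * r))); last by ring.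
apply: (covering_estimate mu_mms D_ge2 muD r0 _ (ler0n R 2)
  (borelI_ball x r mE) (@subIsetr _ _ _) (local_estimate mE r0 small)).
by rewrite !mulr_ge0 ?exprn_ge0// ltW.
Qed.

Lemma relative_isoperimetric_of_isoperimetric :
  relative_isoperimetric mu (D `^ (7 + log2 Lambda) * C) (2 * Lambda).
Proof.
move=> x r r0 E mE; have D2 := D_ge2; have C0 := C_gt0; have L1 := Lambda_ge1.
have D0 : 0 < D by lra.
have r20 : 0 < 2 * r by lra.
have Lr0 : 0 < Lambda * r by rewrite mulr_gt0//; lra.
have LLr0 : 0 < 2 * Lambda * r by rewrite -mulrA mulr_gt0.
have Cr0 : 0 < C * r by rewrite mulr_gt0.
have lL0 : 0 <= log2 Lambda by rewrite divr_ge0 ?ln_ge0//; lra.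
have Dpow : D <= D `^ (7 + log2 Lambda).
  by rewrite -[leLHS]powRr1 ?(ltW D0)//; apply: ler_powR; lra.
have m0 := ball_mass_gt0 mu_mms x r0.
have M0 := ball_mass_gt0 mu_mms x LLr0.
have mEC := borelC mE.
rewrite ThetaE// (ball_massE mu_mms x LLr0) inver gt_eqF// muleA.
rewrite lee_pdivlMr// -!EFinM.
set a := Num.min _ _.
have aE : a <= mass_in E x r by rewrite ge_min lexx.
have aEC : a <= mass_in (~` E) x r by rewrite ge_min lexx orbT.
have a0 : 0 <= a by rewrite le_min !mass_in_ge0.
(* If [B(x,r)] itself qualifies, only the inflated ball has to be doubled once, at cost [D]. *)
have [taua|atau] := leP tau (a / m x r).
  have t1 : a / m x r * m x r <= mass_in E x r by rewrite divfK// gt_eqF.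
  have t2 : a / m x r * m x r <= mass_in (~` E) x r by rewrite divfK// gt_eqF.
  apply: (lee_mul_trans (k := D) _ _ _ _ (iso_mass mE r0 taua t1 t2) _ _).
  - exact: ltW.
  - exact: ltW.
  - exact: hausdorff_ge0.
  - rewrite mulrCA ler_wpM2l ?divr_ge0 ?(ltW m0)//.
    by rewrite -mulrA; exact: ball_mass_double.
  - apply: hausdorff_le; apply: setIS; apply: le_ball.
    by rewrite -mulrA ler_peMl ?(ltW Lr0)//; lra.
  - by rewrite -mulrA ler_pM2r.
set b := Num.min (mass_in E x (2 * r)) (mass_in (~` E) x (2 * r)).
(* If [B(x,2r)] qualifies, its inflated ball is already the right one. The radius [2 * r] costs a
   factor [2 <= D], and [Theta] on [B(x,r)] is below [tau <= D ^- 3]. *)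
have [bD|bD] := leP (D ^- 3 * m x (2 * r)) b.
  have /andP[t1 t2] : (D ^- 3 * m x (2 * r) <= mass_in E x (2 * r)) &&
      (D ^- 3 * m x (2 * r) <= mass_in (~` E) x (2 * r)).
    by rewrite -le_min.
  have := iso_mass mE r20 tau_le t1 t2.
  rewrite (_ : Lambda * (2 * r) = 2 * Lambda * r); last by ring.
  move=> isoB.
  apply: (lee_mul_trans (k := 1) _ _ _ _ isoB _ _) => //.
  - by rewrite ltW// mulr_gt0.
  - exact: hausdorff_ge0.
  - by rewrite mul1r ler_pM2r//; exact: ltW (lt_le_trans atau tau_le).
  - rewrite mul1r mulrCA -mulrA ler_pM2r//; lra.
have small : (a%:E <= (D ^+ 4 * (C * r))%:E *
    H (boundary E `&` ball x (2 * Lambda * r)))%E.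
  have [EC|CE] := leP (mass_in E x r) (mass_in (~` E) x r).
    rewrite /a min_l//; exact: small_mass_estimate.
  rewrite /a min_r ?(ltW CE)// -boundaryC; apply: small_mass_estimate => //.
  - by rewrite setCK ltW.
  - by rewrite setCK minC.
(* Replacing the mass of [B(x,r)] by that of its dilate costs the exponent [2 + log2 Lambda]; with
   [D ^+ 4] the total [6 + log2 Lambda] is within the claimed exponent. *)
apply: (lee_mul_trans (k := D `^ (2 + log2 Lambda)) _ _ _ _ small _ _) => //.
- exact: powR_ge0.
- by rewrite mulr_ge0 ?exprn_ge0// ltW.
- exact: hausdorff_ge0.
- rewrite mulrAC ler_pdivrMr// [leRHS]mulrAC mulrC; apply: ler_wpM2r => //.
  exact: ball_mass_dilate.
- rewrite -[leRHS]mulrA mulrA ler_pM2r// -(powR_mulrn 4 (ltW D0)) -powRD; last first.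
    by rewrite (gt_eqF D0) implybT.
  by apply: ler_powR; lra.
Qed.

End isoperimetric.

Theorem theorem1p8 (R : realType) (X : pmetricType R)
    (mu : {measure set (borelType X) -> \bar R}) (D tau C Lambda : R)
    (Xmu : metric_measure_space mu)
    (D_ge2 : 2 <= D) (muD : doubling mu D)
    (tau_gt0 : 0 < tau) (tau_le : tau <= 1 / D ^+ 3)
    (C_gt0 : 0 < C) (Lambda_ge1 : 1 <= Lambda)
    (iso : isoperimetric mu tau C Lambda) :
  relative_isoperimetric mu (D `^ (7 + log2 Lambda) * C) (2 * Lambda).
Proof.
by apply: relative_isoperimetric_of_isoperimetric iso => //; rewrite -div1r.
Qed.
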